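(* For all integers $A,d$ with $0\le A\le d$, $$\sum_{a=0}^A \sum_{i=0}^{d-a} \binom{d}{a+i}\binom{a+i}{i}2^i(2d-2a-i)!\,(2a+i)! \;=\; (d!)^2\,4^{d-A}(A+1)\binom{2A+1}{A}.$$ *)

(* Defs.v *)
From mathcomp Require Export all_boot.

(* Main.v *)
Require Import Defs.
From mathcomp Require Import all_boot.
From mathcomp Require Import zify ring.

(** Write d = n + a.  Factorials regroup so that the inner sum is a constant
    times the convolution
      sum_i 2^i C(2a+i,i) C(2n-i,n)
        = [x^n] (1 - 2x)^-(2a+1) (1 - x)^-(n+1),
    which equals 4^n C(n+a,n) ([diag_coef_even]).  The reason is the identity
    (1 - 2x)^2 = 1 - 4 x(1 - x): multiplying the series by (1 - 2x)^2 lowers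
    2a by 2, and the term x(1 - x) lowers n by one both in the extracted
    coefficient and in the exponent of 1 - x.  This gives a recurrence of
    Pascal type along the diagonal ([diag_coef_rec]).  The inner sum is therefore
    d!^2 4^(d-a) C(2a,a), and summing over a telescopes, because
    (2A+1) C(2A,A), which is (A+1) C(2A+1,A), satisfies the recurrence of
    sum_(a <= A) 4^(A-a) C(2a,a). *)

(** The coefficient of x^m in (1 - 2x)^-(b+1) (1 - x)^-(n+1). *)
Definition coef_prod (b n m : nat) : nat :=
  \sum_(i < m.+1) 2 ^ i * 'C(b + i, i) * 'C(n + (m - i), n).

Lemma coef_prod0 b n : coef_prod b n 0 = 1.
Proof. by rewrite /coef_prod big_ord_recl big_ord0 !bin0 !addn0 binn. Qed.

(** Multiplication of the series by 1 - x. *)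
Lemma coef_prod_recn b n m :
  coef_prod b n.+1 m.+1 = coef_prod b n.+1 m + coef_prod b n m.+1.
Proof.
rewrite /coef_prod big_ord_recr [in RHS](@big_ord_recr _ _ _ m.+1) /= addnA.
rewrite subnn !addn0 !binn -big_split /=; congr (_ + _).
apply: eq_bigr => i _; rewrite -mulnDr; congr (_ * _).
have le_im : i <= m by rewrite -ltnS.
by rewrite subSn // addnS binS addSnnS.
Qed.

(** Multiplication of the series by 1 - 2x. *)
Lemma coef_prod_recb b n m :
  coef_prod b.+1 n m.+1 = 2 * coef_prod b.+1 n m + coef_prod b n m.+1.
Proof.
rewrite /coef_prod big_ord_recl [in RHS](@big_ord_recl _ _ _ m.+1) /=.
rewrite !addn0 !bin0 addnCA; congr (_ + _).
rewrite big_distrr -big_split /=; apply: eq_bigr => i _.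
rewrite /bump /= add1n subSS addnS binS expnS addSnnS; ring.
Qed.

(** Multiplication of (1 - 2x)^-1 (1 - x)^-(n+1) by 1 - 2x. *)
Lemma coef_prod_rec0 n m :
  coef_prod 0 n m.+1 = 2 * coef_prod 0 n m + 'C(n + m.+1, n).
Proof.
rewrite /coef_prod big_ord_recl /= bin0 !mul1n subn0 addnC; congr (_ + _).
rewrite big_distrr /=; apply: eq_bigr => i _.
by rewrite /bump /= add1n subSS !add0n !binn expnS !mulnA.
Qed.

(** Multiply (1 - 2x)^-(b+3) (1 - x)^-(n+2) by (1 - 2x)^2 = 1 - 4 x(1 - x) and
    extract the coefficient of x^(n+1): in the term x(1 - x), the factor x
    lowers the index to n and the factor 1 - x turns the second exponent into
    n+1, so the result is again a diagonal coefficient. *)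
Lemma diag_coef_rec b n :
  coef_prod b.+2 n.+1 n.+1 = 4 * coef_prod b.+2 n n + coef_prod b n.+1 n.+1.
Proof.
(* For n = 0 the coefficient of x^(n-1) used below does not exist. *)
case: n => [|n].
  by rewrite !coef_prod_recb !coef_prod0; lia.
(* The three uses of [coef_prod_recb] multiply by (1 - 2x)^2, and the use of
   [coef_prod_recn] multiplies the remainder by 1 - x. *)
have := coef_prod_recb b.+1 n.+2 n.+1; have := coef_prod_recb b n.+2 n.+1.
have := coef_prod_recb b.+1 n.+2 n; have := coef_prod_recn b.+2 n.+1 n.
lia.
Qed.

(** The same multiplication by (1 - 2x)^2, applied to (1 - 2x)^-1 (1 - x)^-(n+2),
    leaves (1 - 2x) (1 - x)^-(n+2), whose coefficient of x^(n+1) is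
    C(2n+2,n+1) - 2 C(2n+1,n+1) = 0; so each diagonal coefficient is four times
    the preceding one. *)
Lemma diag_coef0 n : coef_prod 0 n n = 4 ^ n.
Proof.
elim: n => [|n IHn]; first exact: coef_prod0.
have := coef_prod_rec0 n.+1 n; have := coef_prod_recn 0 n n.
have := coef_prod_rec0 n n.
have -> : 'C(n.+1 + n.+1, n.+1) = 2 * 'C(n + n.+1, n).
  rewrite addSn binS -[in X in X + _ = _](@bin_sub _ n.+1) ?leq_addl //.
  by rewrite addnK mul2n addnn.
by rewrite expnS IHn; lia.
Qed.

(** By [diag_coef_rec], the quotient by 4^n satisfies Pascal's rule in (n, a). *)
Lemma diag_coef_even a n : coef_prod a.*2 n n = 4 ^ n * 'C(n + a, n).
Proof.
elim: a n => [|a IHa] n; first by rewrite diag_coef0 addn0 binn muln1.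
elim: n => [|n IHn]; first by rewrite coef_prod0 bin0.
rewrite doubleS diag_coef_rec -doubleS IHn IHa expnS.
by rewrite [n.+1 + a.+1]addSn binS addSnnS; ring.
Qed.

(** C(n+a,a+i) C(a+i,i) is the multinomial (n+a)! / ((n-i)! i! a!); its
    denominator (n-i)! i! is what turns the two other factorials into
    C(2n-i,n) and C(2a+i,i). *)
Lemma inner_term n a i : i <= n ->
  'C(n + a, a + i) * 'C(a + i, i) * 2 ^ i * (2 * n - i)`! * (2 * a + i)`!
  = (n + a)`! * n`! * a`! * 'C(2 * a, a)
    * (2 ^ i * 'C(a.*2 + i, i) * 'C(n + (n - i), n)).
Proof.
move=> le_in.
have multinomial :
    'C(n + a, a + i) * 'C(a + i, i) * (i`! * a`! * (n - i)`!) = (n + a)`!.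
  have le_ai : a + i <= n + a by rewrite addnC leq_add2r.
  rewrite -(bin_fact le_ai) -(bin_fact (leq_addl a i)) addnK.
  have -> : n + a - (a + i) = n - i by lia.
  by ring.
have -> : (2 * n - i)`! = 'C(n + (n - i), n) * (n`! * (n - i)`!).
  have := bin_fact (leq_addr (n - i) n); rewrite addKn => ->.
  by congr (_`!); lia.
have -> : (2 * a + i)`! = 'C(a.*2 + i, i) * (i`! * ('C(2 * a, a) * (a`! * a`!))).
  have := bin_fact (leq_addl a a); rewrite addnK addnn -mul2n => ->.
  by have := bin_fact (leq_addl (2 * a) i); rewrite addnK => ->.
by rewrite -multinomial; ring.
Qed.

Lemma inner_sum n a :
  \sum_(0 <= i < n.+1) 'C(n + a, a + i) * 'C(a + i, i) * 2 ^ i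
     * (2 * n - i)`! * (2 * a + i)`!
  = (n + a)`! ^ 2 * (4 ^ n * 'C(2 * a, a)).
Proof.
rewrite big_mkord (eq_bigr _ (fun (i : 'I_n.+1) _ => @inner_term n a i (ltn_ord i))).
rewrite -big_distrr /= -/(coef_prod a.*2 n n) diag_coef_even.
by have := bin_fact (leq_addr a n); rewrite addKn => <-; ring.
Qed.

Lemma central_binS m :
  m.+1 * 'C(2 * m.+1, m.+1) = 2 * ((2 * m).+1 * 'C(2 * m, m)).
Proof.
have def2m1 : 2 * m.+1 = (2 * m).+2 by lia.
have middle : 'C((2 * m).+1, m) = 'C((2 * m).+1, m.+1).
  by rewrite -bin_sub; [congr 'C(_, _); lia | lia].
by rewrite def2m1 -mul_bin_diag middle -def2m1 -mulnA -mul_bin_diag.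
Qed.

Lemma sum_central_bin A :
  \sum_(0 <= a < A.+1) 4 ^ (A - a) * 'C(2 * a, a) = (2 * A).+1 * 'C(2 * A, A).
Proof.
elim: A => [|A IHA]; first by rewrite big_nat1.
rewrite big_nat_recr //= subnn mul1n.
have -> : \sum_(0 <= a < A.+1) 4 ^ (A.+1 - a) * 'C(2 * a, a)
        = 4 * ((2 * A).+1 * 'C(2 * A, A)).
  rewrite -IHA big_distrr /=; apply: eq_big_nat => a /andP[_ lt_aA].
  by rewrite subSn // expnS mulnA.
by have := central_binS A; nia.
Qed.

Theorem mainTheorem4 (A d : nat) (hAd : A <= d) :
  \sum_(0 <= a < A.+1) \sum_(0 <= i < (d - a).+1)
     'C(d, a + i) * 'C(a + i, i) * 2 ^ i
       * (2 * d - 2 * a - i)`! * (2 * a + i)`!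
  = d`! ^ 2 * 4 ^ (d - A) * (A + 1) * 'C(2 * A + 1, A).
Proof.
transitivity (\sum_(0 <= a < A.+1)
    d`! ^ 2 * 4 ^ (d - A) * (4 ^ (A - a) * 'C(2 * a, a))).
  apply: eq_big_nat => a /andP[_ lt_aA].
  have := inner_sum (d - a) a; rewrite subnK ?(leq_trans _ hAd) // mulnBr => ->.
  by rewrite !mulnA -(mulnA _ (4 ^ (d - A))) -expnD addnBA // subnK.
rewrite -big_distrr /= sum_central_bin -!mulnA; congr (_ * _).
rewrite !addn1 mul_bin_diag -bin_sub; last by lia.
by have -> : (2 * A).+1 - A.+1 = A by lia.
Qed.
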